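(* Let $\Delta t>0$, let $f^0\ge0$, and let $(f^n,r^n)_{n\ge0}$ be produced by the scheme SAV-2nd-L: $r^0=\sqrt{H(f^0)}$; $(f^1,r^1)$ is obtained from $(f^0,r^0)$ by one step of the first order scheme SAV-1st-L (described in the context); and for all $n\ge1$ the following two steps are performed. Step 1 (prediction): $(\tilde f^{n+1},r^{n+1})$ solves $$\frac{3\tilde f^{n+1}-4f^n+f^{n-1}}{2\Delta t}=\frac{r^{n+1}}{\sqrt{H^{n+1,*}}}\,Q(f^{n+1,*}),$$ $$\frac{3r^{n+1}-4r^n+r^{n-1}}{2\Delta t}=\frac{1}{2\sqrt{H^{n+1,*}}}\int_\Omega\log f^{n+1,*}\,\frac{3\tilde f^{n+1}-4f^n+f^{n-1}}{2\Delta t}\,dv.$$ Step 2 (correction): $(f^{n+1},\lambda^{n+1})$ solves, for all $v\in\Omega$, $$\frac{3f^{n+1}(v)-3\tilde f^{n+1}(v)}{2\Delta t}=\lambda^{n+1}(v),\qquad \lambda^{n+1}(v)\ge0,\quad f^{n+1}(v)\ge0,\quad \lambda^{n+1}(v)f^{n+1}(v)=0.$$ Here $H^{n+1,*}=H(f^{n+1,*})>0$ and, pointwise in $v$, $$f^{n+1,*}=\begin{cases}2f^n-f^{n-1},&\text{if } f^n\ge f^{n-1},\\[2pt] \dfrac{1}{2/f^n-1/f^{n-1}},&\text{otherwise.}\end{cases}$$ Then for every step size $\Delta t>0$: (1) $f^n\ge0$ for all $n\ge0$; (2) (modified entropy dissipation) for all $n\ge1$, with $\tilde H^n=\frac12(r^n)^2+\frac12(2r^n-r^{n-1})^2$,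 $$\tilde H^{n+1}-\tilde H^n=-\frac12(r^{n+1}-2r^n+r^{n-1})^2+\frac{\Delta t\,(r^{n+1})^2}{H^{n+1,*}}\int_\Omega Q(f^{n+1,*})\log f^{n+1,*}\,dv\le0.$$
   Context: The scheme is a time discretization of the spatially homogeneous kinetic equation $\partial_t f=Q(f)$, $f=f(t,v)$. The velocity variable $v$ is kept continuous and ranges over a bounded (truncated) domain $\Omega\subset\mathbb{R}^d$; $f^n,\tilde f^{n},f^{n,*},\lambda^{n}$ are real-valued functions of $v\in\Omega$ and each $r^n$ is a real number. The collision operator $Q$ (mapping functions on $\Omega$ to functions on $\Omega$) is assumed to satisfy, for every nonnegative function $f$ to which it is applied: - conservation: $\int_\Omega Q(f)\,dv=0$, $\int_\Omega Q(f)\,v\,dv=0$, $\int_\Omega Q(f)\,|v|^2\,dv=0$; - H-theorem: $\int_\Omega Q(f)\log f\,dv\le0$. $H(f)=\int_\Omega f\log f\,dv+C$, where the real constant $C$ is chosen so that $H$ is positive for the functions at which it is evaluated. One step of SAV-1st-L from $(f^0,r^0)$: first solve for $(\tilde f^1,r^1)$ from $$\frac{\tilde f^{1}-f^0}{\Delta t}=\frac{r^{1}}{\sqrt{H(f^0)}}Q(f^0),\qquad \frac{r^{1}-r^0}{\Delta t}=\frac{1}{2\sqrt{H(f^0)}}\int_\Omega\log f^0\,\frac{\tilde f^{1}-f^0}{\Delta t}\,dv,$$ then $(f^1,\lambda^1)$ from $\frac{f^1(v)-\tilde f^1(v)}{\Delta t}=\lambda^1(v)$, $\lambda^1(v)\ge0$,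 $f^1(v)\ge0$, $\lambda^1(v)f^1(v)=0$ for all $v\in\Omega$. At points where $f^n=0<f^{n-1}$, the second case of $f^{n+1,*}$ is read as $f^nf^{n-1}/(2f^{n-1}-f^n)=0$. Conventions: $\log0=-\infty$ and $0\cdot(-\infty)=0$; it is a standing assumption that all integrals appearing are well defined and finite. *)

(* Defs.v *)
From HB Require Import structures.
From mathcomp Require Import all_boot all_order all_algebra.
From mathcomp Require Import all_classical all_reals all_analysis.

Set Implicit Arguments.
Unset Strict Implicit.
Unset Printing Implicit Defensive.

Import Order.TTheory GRing.Theory Num.Theory.
Import numFieldNormedType.Exports.

Local Open Scope classical_set_scope.
Local Open Scope ring_scope.

(* Points of R^d are d-tuples, whose sigma-algebra is the one generated by the
   coordinates, i.e. the Borel sigma-algebra of R^d. *)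
Notation velocity R d := (d.-tuple (measurableTypeR R)).

Section lebesgue_measure_Rd.
Context {R : realType}.
Local Notation RT := (measurableTypeR R).

Definition tuple_of_pair d (x : RT * d.-tuple RT) : d.+1.-tuple RT :=
  [tuple of x.1 :: x.2].

Definition pair_of_tuple d (t : d.+1.-tuple RT) : RT * d.-tuple RT :=
  (thead t, [tuple of behead t]).

Lemma tuple_of_pairK d : cancel (@tuple_of_pair d) (@pair_of_tuple d).
Proof.
by case=> x t; congr (_, _); apply: val_inj.
Qed.

Lemma measurable_tuple_of_pair d : measurable_fun setT (@tuple_of_pair d).
Proof. exact: measurable_cons. Qed.

Lemma measurable_pair_of_tuple d : measurable_fun setT (@pair_of_tuple d).
Proof.
apply/measurable_fun_pairP; split.
- exact: (@measurable_tnth _ RT d.+1 ord0).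
- exact: measurable_behead.
Qed.

Section next_dimension.
Variables (d : nat) (mu : {sigma_finite_measure set (d.-tuple RT) -> \bar R}).

Definition lebesgue_next : set (d.+1.-tuple RT) -> \bar R :=
  pushforward (@lebesgue_measure R \x mu)%E (@tuple_of_pair d).

Let lebesgue_next0 : lebesgue_next set0 = 0%E.
Proof. by rewrite /lebesgue_next /pushforward preimage_set0 measure0. Qed.

Let lebesgue_next_ge0 A : (0 <= lebesgue_next A)%E.
Proof. by rewrite /lebesgue_next /pushforward measure_ge0. Qed.

Let lebesgue_next_sigma_additive : semi_sigma_additive lebesgue_next.
Proof.
rewrite /lebesgue_next; apply: measure_semi_sigma_additive.
exact: measurable_tuple_of_pair.
Qed.

HB.instance Definition _ := isMeasure.Build _ _ _ lebesgue_next
  lebesgue_next0 lebesgue_next_ge0 lebesgue_next_sigma_additive.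

Let lebesgue_next_sigma_finite : sigma_finite setT lebesgue_next.
Proof.
have /sigma_finiteP[F [TF ndF Foo]] := sigma_finiteT (@lebesgue_measure R).
have /sigma_finiteP[G [TG ndG Goo]] := sigma_finiteT mu.
exists (fun n => @pair_of_tuple d @^-1` (F n `*` G n)).
  apply/esym; rewrite -subTset => t _.
  have [n _ Fn] : (\bigcup_n F n) (pair_of_tuple t).1 by rewrite -TF.
  have [m _ Gm] : (\bigcup_n G n) (pair_of_tuple t).2 by rewrite -TG.
  exists (maxn n m) => //; split.
  - by move: Fn; exact/subsetPset/ndF/leq_maxl.
  - by move: Gm; exact/subsetPset/ndG/leq_maxr.
move=> n; have [mF Fn] := Foo n; have [mG Gn] := Goo n; split.
  rewrite -[X in measurable X]setTI; apply: measurable_pair_of_tuple => //.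
  exact: measurableX.
rewrite /lebesgue_next /pushforward -comp_preimage.
rewrite (_ : _ \o _ = id); last by apply/funext => x; exact: tuple_of_pairK.
by rewrite preimage_id product_measure1E// lte_mul_pinfty// ge0_fin_numE.
Qed.

HB.instance Definition _ := Measure_isSigmaFinite.Build _ _ _ lebesgue_next
  lebesgue_next_sigma_finite.

End next_dimension.

Fixpoint lebesgue_measure_Rd (d : nat) :
    {sigma_finite_measure set (d.-tuple RT) -> \bar R} :=
  match d with
  | 0 => (\d_ [tuple] : {sigma_finite_measure set (0.-tuple RT) -> \bar R})
  | d'.+1 => lebesgue_next (lebesgue_measure_Rd d')
  end.

Lemma lebesgue_measure_Rd_box d (A : 'I_d -> set RT) :
  (forall i, measurable (A i)) ->
  lebesgue_measure_Rd d [set t | forall i, A i (tnth t i)] =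
  (\prod_(i < d) @lebesgue_measure R (A i))%E.
Proof.
elim: d A => [|d IH] A mA.
  rewrite big_ord0 /= diracE mem_set//.
  by case.
rewrite big_ord_recl /= /lebesgue_next /pushforward.
set B := [set t : d.-tuple RT | forall i, A (lift ord0 i) (tnth t i)].
have mB : measurable B.
  rewrite (_ : B = \bigcap_(i in [set: 'I_d])
      (fun t => tnth t i) @^-1` (A (lift ord0 i))).
    apply: fin_bigcap_measurable => //= i _.
    by rewrite -[X in measurable X]setTI; exact: measurable_tnth.
  by apply/seteqP; split => [t Bt i _|t Bt i]; [exact: Bt|exact: (Bt i)].
rewrite (_ : _ @^-1` _ = A ord0 `*` B).
  rewrite product_measure1E//; congr (_ * _)%E.
  by apply: IH => i; exact: mA.
apply/seteqP; split => [[x t] /= H|[x t] [/= Ax Bt] i].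
  by split => [|i]; [exact: (H ord0)|have := H (lift ord0 i); rewrite tnthS].
by have [j ->|->] := unliftP ord0 i; [rewrite tnthS; exact: Bt|].
Qed.

End lebesgue_measure_Rd.

Section sav_scheme.
Context {R : realType} {d : nat}.
Variable Omega : set (velocity R d).
Local Notation V := (velocity R d).
Local Notation mu := (lebesgue_measure_Rd d).
Implicit Types (f g h ft lam : V -> R) (C dt r : R).

Definition coordinate (v : V) (i : 'I_d) : R := tnth v i.

Definition sqnorm (v : V) : R := \sum_(i < d) coordinate v i ^+ 2.

Definition bounded_domain : Prop :=
  exists M : R, forall v, Omega v -> sqnorm v <= M.

(* Functions on Omega are represented by functions on R^d of which only the
   values on Omega matter. *)
Definition nonneg_on f : Prop := forall v, Omega v -> 0 <= f v.

(* The integrand (log g) * h takes its values in the extended reals, where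
   lne 0 = -oo and 0 * -oo = 0. *)
Definition log_integrable g h : Prop :=
  mu.-integrable Omega (fun v => lne (g v)%:E * (h v)%:E)%E.

Definition log_integral g h : R :=
  fine (\int[mu]_(v in Omega) (lne (g v)%:E * (h v)%:E))%E.

Definition entropy C g : R := log_integral g g + C.

(* A collision operator comes with the set [collision_dom] of the functions to
   which it can be applied. [collision_local] says that Q is a map between
   functions on Omega; the integrability fields say that the integrals in the
   conservation laws and in the H-theorem make sense. *)
Record collision_operator := CollisionOperator {
  collision_dom : set (V -> R) ;
  collision :> (V -> R) -> V -> R ;
  collision_local : forall f g, collision_dom f -> collision_dom g ->
    (forall v, Omega v -> f v = g v) ->
    forall v, Omega v -> collision f v = collision g v ;
  collision_mass_integrable : forall f, collision_dom f -> nonneg_on f ->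
    mu.-integrable Omega (fun v => (collision f v)%:E) ;
  collision_mass : forall f, collision_dom f -> nonneg_on f ->
    (\int[mu]_(v in Omega) (collision f v)%:E)%E = 0%E ;
  collision_momentum_integrable : forall f, collision_dom f -> nonneg_on f ->
    forall i : 'I_d,
    mu.-integrable Omega (fun v => (collision f v * coordinate v i)%:E) ;
  collision_momentum : forall f, collision_dom f -> nonneg_on f ->
    forall i : 'I_d,
    (\int[mu]_(v in Omega) (collision f v * coordinate v i)%:E)%E = 0%E ;
  collision_energy_integrable : forall f, collision_dom f -> nonneg_on f ->
    mu.-integrable Omega (fun v => (collision f v * sqnorm v)%:E) ;
  collision_energy : forall f, collision_dom f -> nonneg_on f ->
    (\int[mu]_(v in Omega) (collision f v * sqnorm v)%:E)%E = 0%E ;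
  collision_entropy_integrable : forall f, collision_dom f -> nonneg_on f ->
    log_integrable f (collision f) ;
  collision_entropy : forall f, collision_dom f -> nonneg_on f ->
    log_integral f (collision f) <= 0
}.

(* The function g at which Q, log and H are evaluated in a step is admissible:
   Q can be applied to it, and H(g) is finite and positive. *)
Definition admissible (Q : collision_operator) C g : Prop :=
  [/\ collision_dom Q g, log_integrable g g & 0 < entropy C g].

(* One step from (f0, r0) to (f1, r1) of the first order scheme SAV-1st-L. *)
Record sav_1st_L_step (Q : collision_operator) C dt f0 r0 ft1 f1 lam1 r1 :
    Prop := SAV1stLStep {
  sav1_admissible : admissible Q C f0 ;
  sav1_integrable : log_integrable f0 (fun v => (ft1 v - f0 v) / dt) ;
  sav1_f : forall v, Omega v ->
    (ft1 v - f0 v) / dt = r1 / Num.sqrt (entropy C f0) * Q f0 v ;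
  sav1_r :
    (r1 - r0) / dt = 1 / (2 * Num.sqrt (entropy C f0)) *
      log_integral f0 (fun v => (ft1 v - f0 v) / dt) ;
  sav1_correction : forall v, Omega v -> (f1 v - ft1 v) / dt = lam1 v ;
  sav1_lam_ge0 : forall v, Omega v -> 0 <= lam1 v ;
  sav1_f_ge0 : forall v, Omega v -> 0 <= f1 v ;
  sav1_complementarity : forall v, Omega v -> lam1 v * f1 v = 0
}.

(* The function f^{n+1,*}, with fn = f^n and fp = f^{n-1}. Since 0^-1 = 0 in a
   field of MathComp, the value 0 taken at the points where f^n = 0 < f^{n-1}
   has to be singled out. *)
Definition extrapolation (fn fp : V -> R) (v : V) : R :=
  if fp v <= fn v then 2 * fn v - fp v
  else if fn v == 0 then 0
  else 1 / (2 / fn v - 1 / fp v).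

(* One step of SAV-2nd-L from f^{n-1}, f^n, r^{n-1}, r^n (fp, fn, rp, rn) to
   f^{n+1}, r^{n+1} (f1, r1). *)
Record sav_2nd_L_step (Q : collision_operator) C dt (fp fn : V -> R) (rp rn : R)
    ft1 f1 lam1 r1 : Prop := SAV2ndLStep {
  sav2_admissible : admissible Q C (extrapolation fn fp) ;
  sav2_integrable : log_integrable (extrapolation fn fp)
    (fun v => (3 * ft1 v - 4 * fn v + fp v) / (2 * dt)) ;
  sav2_f : forall v, Omega v ->
    (3 * ft1 v - 4 * fn v + fp v) / (2 * dt) =
    r1 / Num.sqrt (entropy C (extrapolation fn fp)) *
      Q (extrapolation fn fp) v ;
  sav2_r :
    (3 * r1 - 4 * rn + rp) / (2 * dt) =
    1 / (2 * Num.sqrt (entropy C (extrapolation fn fp))) *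
      log_integral (extrapolation fn fp)
        (fun v => (3 * ft1 v - 4 * fn v + fp v) / (2 * dt)) ;
  sav2_correction : forall v, Omega v ->
    (3 * f1 v - 3 * ft1 v) / (2 * dt) = lam1 v ;
  sav2_lam_ge0 : forall v, Omega v -> 0 <= lam1 v ;
  sav2_f_ge0 : forall v, Omega v -> 0 <= f1 v ;
  sav2_complementarity : forall v, Omega v -> lam1 v * f1 v = 0
}.

(* f n, ft n, lam n, r n are f^n, tilde f^n, lambda^n, r^n; the values of ft
   and lam at 0 are irrelevant. *)
Record sav_2nd_L (Q : collision_operator) C dt
    (f ft lam : nat -> V -> R) (r : nat -> R) : Prop := SAV2ndL {
  sav_init : r 0%N = Num.sqrt (entropy C (f 0%N)) ;
  sav_first_step :
    sav_1st_L_step Q C dt (f 0%N) (r 0%N) (ft 1%N) (f 1%N) (lam 1%N) (r 1%N) ;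
  sav_next_step : forall n, (1 <= n)%N ->
    sav_2nd_L_step Q C dt (f n.-1) (f n) (r n.-1) (r n)
      (ft n.+1) (f n.+1) (lam n.+1) (r n.+1)
}.

End sav_scheme.

(* The modified entropy; rn = r^n and rp = r^{n-1}. *)
Definition modified_entropy (R : realType) (rn rp : R) : R :=
  1 / 2 * rn ^+ 2 + 1 / 2 * (2 * rn - rp) ^+ 2.

(* Main.v *)
Require Import Defs.
From mathcomp Require Import all_boot all_order all_algebra.
From mathcomp Require Import all_classical all_reals all_analysis.
From mathcomp Require Import ring lra.

(** Nonnegativity is built into both correction steps. Consequently the
    extrapolation [f*] is nonnegative: where [f] grows it is
    [f^n + (f^n - f^{n-1})]; where [f] decreases to a positive value, the
    reciprocal of [f*] is [1/f^n + (1/f^n - 1/f^{n-1})]; where [f] drops to [0],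
    so does [f*]. The integrability of [Q f* log f*] and the
    H-theorem therefore apply to [f*].

    For the entropy law, the prediction equation says that the discrete
    derivative of [f] is [r^{n+1}/sqrt H] times [Q f*] on the domain, so by
    linearity of the integral ([log_integralZ]) the equation for [r] reads
    [3 r^{n+1} - 4 r^n + r^{n-1} = dt r^{n+1} / H * D], where [D] is the integral
    of [Q f* log f*] ([sav2_r_eq]). Multiplying by [r^{n+1}] and using the
    G-stability identity of the two-step backward differentiation formula
    ([modified_entropy_increment]) turns this into the claimed balance; its
    right-hand side is nonpositive because [D <= 0], for any positive step size.
    The correction step does not involve [r], so it cannot spoil the balance. *)

Import Order.TTheory GRing.Theory Num.Theory.
Local Open Scope classical_set_scope.
Local Open Scope ring_scope.

Section log_integral.
Context {R : realType} {d : nat}.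
Context {Omega : set (velocity R d)}.
Hypothesis mOmega : measurable Omega.
Implicit Types (g h q : velocity R d -> R).

(** The form in which the scheme provides its equations: the discrete derivative
    [h] is a constant times the collision term [q], but only on the domain of
    integration. *)
Lemma log_integralZ {g h q} {k : R} :
  log_integrable Omega g q ->
  (forall v, Omega v -> h v = k * q v) ->
  log_integral Omega g h = k * log_integral Omega g q.
Proof.
move=> iq hE; rewrite /log_integral.
under eq_integral => v /set_mem Ov do rewrite (hE v Ov) EFinM muleCA.
by rewrite integralZl// fineM// integrable_fin_num.
Qed.

End log_integral.

Section extrapolation.
Context {R : realType} {d : nat}.
Context {Omega : set (velocity R d)}.
Implicit Types (fn fp : velocity R d -> R).

Lemma extrapolation_ge0 {fn fp} :
  nonneg_on Omega fn -> nonneg_on Omega fp ->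
  nonneg_on Omega (extrapolation fn fp).
Proof.
move=> fn0 fp0 v Ov; rewrite /extrapolation.
have := fn0 v Ov; have := fp0 v Ov.
move: (fn v) (fp v) => a b b0 a0.
case: ifPn => [ba|]; first by lra.
rewrite -ltNge => ab; case: eqVneq => [//|an0].
have ap : 0 < a by rewrite lt0r an0.
have bp : 0 < b by exact: lt_trans ab.
have ba' : b^-1 <= a^-1 by rewrite lef_pV2 ?posrE// ltW.
have ai : 0 < a^-1 by rewrite invr_gt0.
by apply: divr_ge0 => //; lra.
Qed.

End extrapolation.

(** G-stability of the two-step backward differentiation formula: testing the
    discrete derivative with [r1] telescopes up to a square. *)
Lemma modified_entropy_increment (R : realType) (r1 rn rp : R) :
  modified_entropy r1 rn - modified_entropy rn rp =
  - (1 / 2) * (r1 - 2 * rn + rp) ^+ 2 + r1 * (3 * r1 - 4 * rn + rp).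
Proof. by rewrite /modified_entropy; field. Qed.

Section second_order_step.
Context {R : realType} {d : nat}.
Context {Omega : set (velocity R d)}.
Hypothesis mOmega : measurable Omega.

(** Eliminating the predicted density: the two factors [1 / sqrt H] coming from
    the two prediction equations combine into [1 / H]. *)
Lemma sav2_r_eq {Q : collision_operator Omega} {C dt : R}
    {fp fn ft1 f1 lam1 : velocity R d -> R} {rp rn r1 : R} :
  0 < dt -> nonneg_on Omega fp -> nonneg_on Omega fn ->
  sav_2nd_L_step Q C dt fp fn rp rn ft1 f1 lam1 r1 ->
  let fstar := extrapolation fn fp in
  3 * r1 - 4 * rn + rp =
  dt * r1 / entropy Omega C fstar * log_integral Omega fstar (Q fstar).
Proof.
move=> dt0 fp0 fn0 [[dom _ H0] _ Ef Er _ _ _ _] /=.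
have iQ := collision_entropy_integrable dom (extrapolation_ge0 fn0 fp0).
move: Er; rewrite (log_integralZ mOmega iQ Ef) => Er.
move: H0 Er; set H := entropy _ _ _; set D := log_integral _ _ _ => H0 Er.
have s0 : Num.sqrt H != 0 by rewrite gt_eqF// sqrtr_gt0.
rewrite -[H in RHS]sqr_sqrtr ?ltW//.
have dtn0 : dt != 0 by rewrite gt_eqF.
have -> : 3 * r1 - 4 * rn + rp = (3 * r1 - 4 * rn + rp) / (2 * dt) * (2 * dt).
  by field.
by rewrite Er; field.
Qed.

End second_order_step.

Theorem theorem4p3 (R : realType) (d : nat) (Omega : set (velocity R d))
    (mOmega : measurable Omega) (bOmega : bounded_domain Omega)
    (Q : collision_operator Omega) (C dt : R)
    (f ft lam : nat -> velocity R d -> R) (r : nat -> R) :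
  0 < dt ->
  nonneg_on Omega (f 0%N) ->
  sav_2nd_L Q C dt f ft lam r ->
  (forall n : nat, nonneg_on Omega (f n)) /\
  (forall n : nat, (1 <= n)%N ->
     let fstar := extrapolation (f n) (f n.-1) in
     let dissipation :=
       - (1 / 2) * (r n.+1 - 2 * r n + r n.-1) ^+ 2 +
       dt * r n.+1 ^+ 2 / entropy Omega C fstar *
         log_integral Omega fstar (Q fstar) in
     modified_entropy (r n.+1) (r n) - modified_entropy (r n) (r n.-1)
       = dissipation /\
     dissipation <= 0).
Proof.
move=> dt0 f00 [_ step1 step].
have f_ge0 n : nonneg_on Omega (f n).
  case: n => [//|[|n]]; first exact: sav1_f_ge0 step1.
  exact: sav2_f_ge0 (step n.+1 isT).
split=> // n n1 /=.
have stepn := step n n1.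
split.
  rewrite modified_entropy_increment.
  by rewrite (sav2_r_eq mOmega dt0 (f_ge0 _) (f_ge0 _) stepn); ring.
have [dom _ H0] := sav2_admissible stepn.
have D0 := collision_entropy dom (extrapolation_ge0 (f_ge0 n) (f_ge0 n.-1)).
rewrite -[0]addr0 lerD//.
  by rewrite mulNr oppr_le0 mulr_ge0// ?sqr_ge0// divr_ge0.
rewrite mulr_ge0_le0// divr_ge0 ?(ltW H0)//.
by rewrite mulr_ge0 ?sqr_ge0// ltW.
Qed.
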